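(* Let $N,K\ge 1$. Every idempotent $e\in\mathcal{J}$ with $\overline{e}^{\ast}=e$ has a decomposition $$e=f_1+f_2+\dots+f_l$$ into primitive idempotents $f_1,\dots,f_l\in\mathbb{C}[\mathcal{S}_N]$ which fulfil $\overline{f_i}^{\ast}=f_i$ for all $i$ and $f_i\cdot f_j=0$ for all $i\neq j$.
   Context: $\mathcal{S}_N$ is the symmetric group of permutations of $\{1,\dots,N\}$ with product $(p\circ q)(i)=p(q(i))$, and $\mathbb{C}[\mathcal{S}_N]$ is its complex group ring. For $a=\sum_p a_p\,p$ put $\overline{a}:=\sum_p\overline{a_p}\,p$ and $a^{\ast}:=\sum_p a_p\,p^{-1}$; thus $\overline{a}^{\ast}=\sum_p\overline{a_p}\,p^{-1}$. $\mathcal{H}$ is the complex Hilbert space with orthonormal basis $\{|\sigma\rangle\}$ indexed by all functions $\sigma:\{1,\dots,N\}\to\{1,\dots,K\}$. A permutation acts by $p|\sigma\rangle:=|\sigma\circ p^{-1}\rangle$, and $\mathbb{C}[\mathcal{S}_N]$ acts on $\mathcal{H}$ by linear extension. $\mathcal{J}_0:=\{a\in\mathbb{C}[\mathcal{S}_N] : au=0\ \text{for all } u\in\mathcal{H}\}$ is a two-sided ideal; let $f_0$ be its unique central generating idempotent, and let $\mathcal{J}:=(\mathrm{id}-f_0)\cdot\mathbb{C}[\mathcal{S}_N]$ be the complementary two-sided ideal, so that $\mathbb{C}[\mathcal{S}_N]=\mathcal{J}\oplus\mathcal{J}_0$. An idempotent is primitive if it is nonzero and is not the sum of two nonzero idempotents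 $g,h$ with $g\cdot h=h\cdot g=0$. *)

(* Defs.v *)
From HB Require Import structures.
From mathcomp Require Import all_boot all_order all_algebra all_fingroup.
From mathcomp Require Import spectral complex reals.

Set Implicit Arguments.
Unset Strict Implicit.
Unset Printing Implicit Defensive.

Import Order.TTheory GRing.Theory Num.Theory.

Local Open Scope ring_scope.

(* [(s * t)%g] maps [i] to [t (s i)], so composition is the reversed product. *)
Definition pcomp (N : nat) (p q : 'S_N) : 'S_N := (q * p)%g.

Lemma pcompE (N : nat) (p q : 'S_N) (i : 'I_N) : pcomp p q i = p (q i).
Proof. by rewrite permM. Qed.

(* A type of its own because {ffun 'S_N -> R[i]} already carries the pointwise
   product as its canonical ring structure. *)
Record sgring (R : realType) (N : nat) : Type :=
  SGRing { sgfun : {ffun 'S_N -> R[i]^o} }.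

Definition gcoef (R : realType) (N : nat) (a : sgring R N) (p : 'S_N) : R[i] :=
  sgfun a p.

Section ModuleStructure.
Context {R : realType} {N : nat}.
Implicit Types (a b c : sgring R N).

HB.instance Definition _ := [isNew for @sgfun R N].
HB.instance Definition _ := [Choice of sgring R N by <:].

Let zero : sgring R N := SGRing 0.
Let opp a := SGRing (- sgfun a).
Let add a b := SGRing (sgfun a + sgfun b).
Let scale (k : R[i]) a := SGRing (k *: sgfun a).

Fact sgaddA : associative add.
Proof. by move=> a b c; rewrite /add addrA. Qed.
Fact sgaddC : commutative add.
Proof. by move=> a b; rewrite /add addrC. Qed.
Fact sgadd0 : left_id zero add.
Proof. by case=> a; rewrite /add add0r. Qed.
Fact sgaddN : left_inverse zero opp add.
Proof. by move=> a; rewrite /add addNr. Qed.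
HB.instance Definition _ :=
  GRing.isZmodule.Build (sgring R N) sgaddA sgaddC sgadd0 sgaddN.

Fact sgscaleA (k l : R[i]) a : scale k (scale l a) = scale (k * l) a.
Proof. by rewrite /scale scalerA. Qed.
Fact sgscale1 : left_id 1 scale.
Proof. by case=> a; rewrite /scale scale1r. Qed.
Fact sgscaleDr : right_distributive scale +%R.
Proof. by move=> k a b; rewrite /scale scalerDr. Qed.
Fact sgscaleDl a : {morph scale^~ a : k l / k + l}.
Proof. by move=> k l; rewrite /scale scalerDl. Qed.
HB.instance Definition _ := GRing.Zmodule_isLmodule.Build R[i] (sgring R N)
  sgscaleA sgscale1 sgscaleDr sgscaleDl.

Fact sgvect_axiom : Vector.axiom #|'S_N| (sgring R N).
Proof.
exists (fun a => \row_j sgfun a (enum_val j)) => [k a b|].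
  by apply/rowP => j; rewrite !mxE !ffunE.
exists (fun w : 'rV_#|'S_N| => SGRing [ffun p => w 0 (enum_rank p)]).
  by case=> a; congr SGRing; apply/ffunP => p; rewrite ffunE mxE enum_rankK.
by move=> w; apply/rowP => j; rewrite mxE ffunE enum_valK.
Qed.
HB.instance Definition _ :=
  Lmodule_hasFinDim.Build R[i] (sgring R N) sgvect_axiom.

End ModuleStructure.

Definition sgperm (R : realType) (N : nat) (p : 'S_N) : sgring R N :=
  SGRing [ffun q => (q == p)%:R].

Definition sgmul (R : realType) (N : nat) (a b : sgring R N) : sgring R N :=
  \sum_p \sum_q (gcoef a p * gcoef b q) *: sgperm R (pcomp p q).

Section RingStructure.
Context {R : realType} {N : nat}.
Implicit Types (a b c : sgring R N) (p q r : 'S_N).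

Lemma sgringP a b : gcoef a =1 gcoef b <-> a = b.
Proof.
by case: a b => [a] [b]; split=> [ab|->//]; congr SGRing; apply/ffunP.
Qed.

Lemma gcoefD a b p : gcoef (a + b) p = gcoef a p + gcoef b p.
Proof. by rewrite /gcoef ffunE. Qed.
Lemma gcoefZ k a p : gcoef (k *: a) p = k * gcoef a p.
Proof. by rewrite /gcoef ffunE. Qed.
Lemma gcoef_sum I (s : seq I) (P : pred I) (F : I -> sgring R N) p :
  gcoef (\sum_(i <- s | P i) F i) p = \sum_(i <- s | P i) gcoef (F i) p.
Proof.
by apply: (big_morph (fun a => gcoef a p)) => [a b|]; rewrite /gcoef ffunE.
Qed.
Lemma gcoef_lin (I : finType) (k : I -> R[i]) (F : I -> sgring R N) p :
  gcoef (\sum_i k i *: F i) p = \sum_i k i * gcoef (F i) p.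
Proof. by rewrite gcoef_sum; apply: eq_bigr => i _; exact: gcoefZ. Qed.
Lemma gcoef_perm p q : gcoef (sgperm R p) q = (q == p)%:R.
Proof. by rewrite /gcoef ffunE. Qed.

Lemma gcoef_mul a b r :
  gcoef (sgmul a b) r = \sum_p gcoef a p * gcoef b (r * p^-1)%g.
Proof.
rewrite gcoef_sum; apply: eq_bigr => p _; rewrite gcoef_lin.
rewrite (bigD1 (r * p^-1)%g) //= gcoef_perm /pcomp mulgKV eqxx mulr1.
rewrite big1 ?addr0 // => q qNrp; rewrite gcoef_perm.
case: eqP => [rqp|]; last by rewrite mulr0.
by rewrite rqp mulgK eqxx in qNrp.
Qed.

Fact sgmulA : associative (@sgmul R N).
Proof.
move=> a b c; apply/sgringP => r; rewrite !gcoef_mul.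
under [RHS]eq_bigr do rewrite gcoef_mul mulr_suml.
rewrite exchange_big /=; apply: eq_bigr => p _.
rewrite gcoef_mul mulr_sumr [RHS](reindex_inj (mulIg p)) /=.
by apply: eq_bigr => q _; rewrite mulgK invMg mulgA mulrA.
Qed.

Fact sgmul1l : left_id (sgperm R 1%g) (@sgmul R N).
Proof.
move=> a; apply/sgringP => r; rewrite gcoef_mul (bigD1 1%g) //= gcoef_perm eqxx.
rewrite mul1r invg1 mulg1 big1 ?addr0 // => p pN1.
by rewrite gcoef_perm (negPf pN1) mul0r.
Qed.

Fact sgmul1r : right_id (sgperm R 1%g) (@sgmul R N).
Proof.
move=> a; apply/sgringP => r; rewrite gcoef_mul (bigD1 r) //= gcoef_perm mulgV.
rewrite eqxx mulr1 big1 ?addr0 // => p pNr.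
rewrite gcoef_perm -eq_mulgV1 eq_sym.
by rewrite (negPf pNr) mulr0.
Qed.

Fact sgmulDl : left_distributive (@sgmul R N) +%R.
Proof.
move=> a b c; apply/sgringP => r; rewrite gcoefD !gcoef_mul -big_split /=.
by apply: eq_bigr => p _; rewrite gcoefD mulrDl.
Qed.

Fact sgmulDr : right_distributive (@sgmul R N) +%R.
Proof.
move=> a b c; apply/sgringP => r; rewrite gcoefD !gcoef_mul -big_split /=.
by apply: eq_bigr => p _; rewrite gcoefD mulrDr.
Qed.

Fact sgone_neq0 : sgperm R (1%g : 'S_N) != 0.
Proof.
apply/eqP => /(congr1 (fun a => gcoef a 1%g)) /eqP.
by rewrite gcoef_perm eqxx /gcoef ffunE oner_eq0.
Qed.

HB.instance Definition _ := GRing.Zmodule_isNzRing.Build (sgring R N)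
  sgmulA sgmul1l sgmul1r sgmulDl sgmulDr sgone_neq0.

Fact sgscaleAl (k : R[i]) a b : k *: (a * b) = (k *: a) * b.
Proof.
apply/sgringP => r; rewrite gcoefZ !gcoef_mul mulr_sumr.
by apply: eq_bigr => p _; rewrite gcoefZ mulrA.
Qed.
HB.instance Definition _ :=
  GRing.Lmodule_isLalgebra.Build R[i] (sgring R N) sgscaleAl.

Fact sgscaleAr (k : R[i]) a b : k *: (a * b) = a * (k *: b).
Proof.
apply/sgringP => r; rewrite gcoefZ !gcoef_mul mulr_sumr.
by apply: eq_bigr => p _; rewrite gcoefZ mulrCA.
Qed.
HB.instance Definition _ :=
  GRing.Lalgebra_isAlgebra.Build R[i] (sgring R N) sgscaleAr.

End RingStructure.

Definition sgconj (R : realType) (N : nat) (a : sgring R N) : sgring R N :=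
  \sum_p Num.conj (gcoef a p) *: sgperm R p.

Definition sgstar (R : realType) (N : nat) (a : sgring R N) : sgring R N :=
  \sum_p gcoef a p *: sgperm R (p^-1)%g.

(* A vector is given by its coordinates in the orthonormal basis [ket s]. *)
Definition hspace (R : realType) (N K : nat) : Type :=
  {ffun {ffun 'I_N -> 'I_K} -> R[i]^o}.

HB.instance Definition _ (R : realType) (N K : nat) :=
  Vector.copy (hspace R N K) {ffun {ffun 'I_N -> 'I_K} -> R[i]^o}.

Definition hcoef (R : realType) (N K : nat) (u : hspace R N K)
  (s : {ffun 'I_N -> 'I_K}) : R[i] := fun_of_fin u s.

Definition hdot (R : realType) (N K : nat) (u v : hspace R N K) : R[i] :=
  \sum_s Num.conj (hcoef u s) * hcoef v s.

Definition ket (R : realType) (N K : nat) (s : {ffun 'I_N -> 'I_K}) :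
  hspace R N K := [ffun t => (t == s)%:R].

Lemma hcoef_ket (R : realType) (N K : nat) (s t : {ffun 'I_N -> 'I_K}) :
  hcoef (ket R s) t = (t == s)%:R.
Proof. by rewrite /hcoef ffunE. Qed.

Lemma ket_orthonormal (R : realType) (N K : nat) (s t : {ffun 'I_N -> 'I_K}) :
  hdot (ket R s) (ket R t) = (s == t)%:R.
Proof.
rewrite /hdot (bigD1 s) //= !hcoef_ket eqxx rmorph1 mul1r big1 ?addr0 // => x xs.
by rewrite !hcoef_ket (negPf xs) rmorph0 mul0r.
Qed.

Lemma hcoefZ (R : realType) (N K : nat) k (u : hspace R N K) s :
  hcoef (k *: u) s = k * hcoef u s.
Proof. by rewrite /hcoef ffunE. Qed.

Lemma hcoef_sum (R : realType) (N K : nat) I (l : seq I) (P : pred I)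
    (F : I -> hspace R N K) s :
  hcoef (\sum_(i <- l | P i) F i) s = \sum_(i <- l | P i) hcoef (F i) s.
Proof.
by apply: (big_morph (fun u => hcoef u s)) => [u v|]; rewrite /hcoef ffunE.
Qed.

Lemma hcoef_lin (R : realType) (N K : nat) (I : finType) (k : I -> R[i])
    (F : I -> hspace R N K) s :
  hcoef (\sum_i k i *: F i) s = \sum_i k i * hcoef (F i) s.
Proof. by rewrite hcoef_sum; apply: eq_bigr => i _; exact: hcoefZ. Qed.

Lemma hspaceP (R : realType) (N K : nat) (u v : hspace R N K) :
  hcoef u =1 hcoef v <-> u = v.
Proof. by split=> [uv|->//]; apply/ffunP. Qed.

Lemma ket_span (R : realType) (N K : nat) (u : hspace R N K) :
  u = \sum_s hcoef u s *: ket R s.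
Proof.
apply/hspaceP => t; rewrite hcoef_lin (bigD1 t) //= hcoef_ket eqxx mulr1.
by rewrite big1 ?addr0 // => s st; rewrite hcoef_ket eq_sym (negPf st) mulr0.
Qed.

Definition perm_act (R : realType) (N K : nat) (p : 'S_N) (u : hspace R N K) :
  hspace R N K :=
  \sum_s hcoef u s *: ket R [ffun i => s ((p^-1)%g i)].

Definition sgact (R : realType) (N K : nat) (a : sgring R N)
  (u : hspace R N K) : hspace R N K :=
  \sum_p gcoef a p *: perm_act p u.

Definition annJ0 (R : realType) (N K : nat) (a : sgring R N) : Prop :=
  forall u : hspace R N K, sgact a u = 0.

Definition idempotent_elt (A : nzRingType) (e : A) : Prop := e * e = e.

Definition primitive_idempotent (A : nzRingType) (e : A) : Prop :=
  [/\ idempotent_elt e, e <> 0 &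
    ~ exists g h : A,
        [/\ idempotent_elt g, idempotent_elt h, g <> 0 /\ h <> 0,
            g * h = 0 /\ h * g = 0 & e = g + h]].

Definition central_generating_idempotent (A : nzRingType) (I : A -> Prop)
    (f : A) : Prop :=
  [/\ idempotent_elt f, forall a : A, f * a = a * f &
      forall a : A, I a <-> exists b : A, a = f * b].

Lemma central_generating_idempotent_unique (A : nzRingType) (I : A -> Prop)
    (f g : A) :
  central_generating_idempotent I f -> central_generating_idempotent I g ->
  f = g.
Proof.
move=> [ff fC If] [gg gC Ig].
have /Ig[b fb] : I f by apply/If; exists 1; rewrite mulr1.
have /If[c gc] : I g by apply/Ig; exists 1; rewrite mulr1.
have fg : g * f = f by rewrite {1}fb mulrA gg.
have gf : f * g = g by rewrite {1}gc mulrA ff.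
by rewrite -fg -fC gf.
Qed.

Definition complement_ideal (A : nzRingType) (f0 : A) (a : A) : Prop :=
  exists b : A, a = (1 - f0) * b.

Section Existence.
Context {R : realType} {N : nat}.
Implicit Types (a b c : sgring R N) (p q r : 'S_N).

Let gcoefM a b r : gcoef (a * b) r = \sum_p gcoef a p * gcoef b (r * p^-1)%g.
Proof. exact: gcoef_mul. Qed.

Lemma gcoef_sgconj a p : gcoef (sgconj a) p = Num.conj (gcoef a p).
Proof.
rewrite gcoef_lin (bigD1 p) //= gcoef_perm eqxx mulr1 big1 ?addr0 //.
by move=> q qp; rewrite gcoef_perm eq_sym (negPf qp) mulr0.
Qed.

Lemma gcoef_sgstar a p : gcoef (sgstar a) p = gcoef a (p^-1)%g.
Proof.
rewrite gcoef_lin (bigD1 (p^-1)%g) //= gcoef_perm invgK eqxx mulr1.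
rewrite big1 ?addr0 // => q qp; rewrite gcoef_perm eq_sym -eqg_inv invgK.
by rewrite (negPf qp) mulr0.
Qed.

Let dagger a := sgstar (sgconj a).

Let gcoef_dagger a p : gcoef (dagger a) p = Num.conj (gcoef a (p^-1)%g).
Proof. by rewrite gcoef_sgstar gcoef_sgconj. Qed.

Let daggerK a : dagger (dagger a) = a.
Proof. by apply/sgringP => p; rewrite !gcoef_dagger invgK conjCK. Qed.

Let daggerM a b : dagger (a * b) = dagger b * dagger a.
Proof.
apply/sgringP => r; rewrite gcoef_dagger !gcoefM rmorph_sum /=.
rewrite [RHS](reindex_inj (mulIg r)) /=; apply: eq_bigr => p _.
by rewrite !gcoef_dagger rmorphM mulrC /= !(invMg, invgK) mulgK.
Qed.

Let gtrC a b : gcoef (a * b) 1%g = gcoef (b * a) 1%g.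
Proof.
rewrite !gcoefM (reindex_inj invg_inj) /=.
by apply: eq_bigr => p _; rewrite !mul1g invgK mulrC.
Qed.

Let gdot a b := gcoef (a * dagger b) 1%g.

Let gdotE a b : gdot a b = \sum_p gcoef a p * Num.conj (gcoef b p).
Proof.
rewrite /gdot gcoefM; apply: eq_bigr => p _.
by rewrite gcoef_dagger mul1g invgK.
Qed.

Let gdot_eq0 a : gdot a a = 0 -> a = 0.
Proof.
rewrite gdotE => /eqP; rewrite psumr_eq0 => [|p _]; last exact: mul_conjC_ge0.
move=> /allP a0; apply/sgringP => p; have := a0 p (mem_index_enum p).
by rewrite /= mul_conjC_eq0 => /eqP ->; rewrite /gcoef ffunE.
Qed.

Let gdotMl a b c : gdot (a * b) c = gdot b (dagger a * c).
Proof. by rewrite /gdot -mulrA gtrC daggerM daggerK mulrA. Qed.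

Let gdotMr a b c : gdot (a * b) c = gdot a (c * dagger b).
Proof. by rewrite /gdot daggerM daggerK mulrA. Qed.

Context {K : nat}.
Implicit Types (u v : hspace R N K).

Lemma hcoef_perm_act p u s : hcoef (perm_act p u) s = hcoef u [ffun i => s (p i)].
Proof.
rewrite hcoef_lin (bigD1 [ffun i => s (p i)]) //= hcoef_ket.
have -> : [ffun i => [ffun i => s (p i)] ((p^-1)%g i)] = s.
  by apply/ffunP => i; rewrite !ffunE permKV.
rewrite eqxx mulr1 big1 ?addr0 // => t ts; rewrite hcoef_ket.
case: eqP => [st|]; last by rewrite mulr0.
case/eqP: ts; rewrite st; apply/ffunP => i; by rewrite !ffunE permK.
Qed.

Lemma hcoef_sgact a u s :
  hcoef (sgact a u) s = \sum_p gcoef a p * hcoef u [ffun i => s (p i)].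
Proof.
by rewrite hcoef_lin; apply: eq_bigr => p _; rewrite hcoef_perm_act.
Qed.

Lemma sgactM a b u : sgact (a * b) u = sgact a (sgact b u).
Proof.
apply/hspaceP => s; rewrite !hcoef_sgact.
under eq_bigr do rewrite gcoefM mulr_suml.
rewrite exchange_big /=; apply: eq_bigr => p _.
rewrite hcoef_sgact mulr_sumr (reindex_inj (mulIg p)) /=.
apply: eq_bigr => q _; rewrite mulgK mulrA; congr (_ * hcoef u _).
by apply/ffunP => i; rewrite !ffunE permM.
Qed.

Let annMr a b : annJ0 K a -> annJ0 K (a * b).
Proof. by move=> a0 u; rewrite sgactM. Qed.

Let annMl a b : annJ0 K b -> annJ0 K (a * b).
Proof.
move=> b0 u; rewrite sgactM b0; apply/hspaceP => s; rewrite hcoef_sgact.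
by rewrite big1 => [|p _]; rewrite /hcoef ffunE ?mulr0.
Qed.

Let rowg a : 'rV[R[i]]_#|'S_N| := \row_j gcoef a (enum_val j).
Let grow (w : 'rV[R[i]]_#|'S_N|) : sgring R N :=
  SGRing [ffun p => w 0 (enum_rank p)].
Let rowgK : cancel rowg grow.
Proof.
move=> a; apply/sgringP => p; rewrite /gcoef ffunE mxE.
by rewrite enum_rankK.
Qed.
Let growK : cancel grow rowg.
Proof. by move=> w; apply/rowP => j; rewrite mxE /gcoef ffunE enum_valK. Qed.

(* Row p, column (s, t): the (t, s) matrix entry of the operator of p. *)
Let act_mx :
    'M[R[i]]_(#|'S_N|, #|{: {ffun 'I_N -> 'I_K} * {ffun 'I_N -> 'I_K}}|) :=
  \matrix_(i, j)
    let: st := enum_val j : {ffun 'I_N -> 'I_K} * {ffun 'I_N -> 'I_K} in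
    let p := enum_val i : 'S_N in
    hcoef (ket R st.1) [ffun x => st.2 (p x)].

Let ann_mxP a : annJ0 K a <-> (rowg a <= kermx act_mx)%MS.
Proof.
rewrite (sameP sub_kermxP eqP).
have actE j : (rowg a *m act_mx) 0 j =
    hcoef (sgact a (ket R (enum_val j).1))
          (enum_val j : {ffun 'I_N -> 'I_K} * {ffun 'I_N -> 'I_K}).2.
  rewrite hcoef_sgact mxE [RHS](reindex_onto enum_val enum_rank) /=; last first.
    by move=> p _; rewrite enum_rankK.
  by apply: eq_big => [i|i _]; rewrite ?enum_valK ?eqxx // !mxE.
split=> [a0|/eqP a0 u].
  by apply/eqP/rowP => j; rewrite actE a0 mxE /hcoef ffunE.
apply/hspaceP => t; rewrite hcoef_sgact [in RHS]/hcoef [in RHS]ffunE.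
rewrite [u in LHS]ket_span.
under eq_bigr do rewrite hcoef_lin mulr_sumr.
rewrite exchange_big big1 // => s _; under eq_bigr do rewrite mulrCA.
rewrite -mulr_sumr -hcoef_sgact.
by have := actE (enum_rank (s, t)); rewrite a0 enum_rankK mxE => <-; rewrite mulr0.
Qed.

Lemma annJ0_generator_exists :
  exists f0 : sgring R N, central_generating_idempotent (annJ0 K) f0.
Proof.
pose U := kermx act_mx; pose f := grow (rowg 1 *m proj_ortho U).
have f0 : annJ0 K f by apply/ann_mxP; rewrite growK proj_ortho_sub.
pose g := 1 - f.
have gperp a : annJ0 K a -> gdot g a = 0.
  move=> /ann_mxP aU.
  have rg : rowg g = rowg 1 - rowg 1 *m proj_ortho U.
    rewrite -[X in _ - X]growK; apply/rowP => j.
    by rewrite !mxE /gcoef !ffunE.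
  have := proj_ortho_compl_sub U (rowg 1); rewrite -rg => gU.
  have := submx_trans gU (etrans (submx_ortho _ _) aU).
  move=> /orthomx1P /matrixP/(_ 0 0); rewrite !mxE gdotE => ga0.
  rewrite [LHS](reindex_onto enum_val enum_rank) /= => [|p _]; last first.
    by rewrite enum_rankK.
  rewrite -[RHS]ga0.
  by apply: eq_big => [i|i _]; rewrite ?enum_valK ?eqxx // !mxE.
have fr a : annJ0 K a -> a * f = a.
  move=> a0; apply/eqP; rewrite eq_sym -subr_eq0 -{1}[a]mulr1 -mulrBr -/g.
  apply/eqP/gdot_eq0; rewrite gdotMl; apply: gperp; apply/annMl/annMr/a0.
have fl a : annJ0 K a -> f * a = a.
  move=> a0; apply/eqP; rewrite eq_sym -subr_eq0 -{1}[a]mul1r -mulrBl -/g.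
  apply/eqP/gdot_eq0; rewrite gdotMr; apply: gperp; apply/annMr/annMl/a0.
exists f; split; first exact: fr.
  move=> a; rewrite -[LHS](fr _ (annMr a f0)) -mulrA.
  exact: fl (annMl a f0).
move=> a; split=> [a0|[b ->]]; first by exists a; rewrite fl.
exact: annMr.
Qed.

End Existence.

(* Main.v *)
Require Import Defs.
From HB Require Import structures.
From mathcomp Require Import all_boot all_order all_algebra all_fingroup.
From mathcomp Require Import falgebra boolp.
From mathcomp Require Import complex reals.

(** The proof rests on two properties of the complex group ring: it is a
    finite-dimensional algebra, and the adjoint [a |-> sgstar (sgconj a)] is an
    involution that is definite, in the sense that [a^* a + b^* b = 0] forces
    [a = 0].  Indeed the coefficient at the identity of [a^* a] is the sum of
    the squared moduli of the coefficients of [a].  In any algebra with these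
    two properties every self-adjoint idempotent splits into orthogonal
    self-adjoint primitive ones.

    If a nonzero self-adjoint idempotent [e] is not primitive, then
    [e = g + h] for nonzero orthogonal idempotents, but [g] and [h] need not be
    self-adjoint.  The remedy is a purely algebraic one, going back to
    Kaplansky ([projection_of_idempotent]): there is a self-adjoint idempotent
    [p] generating the same right ideal as [g], so that [p] and [e - p] are
    nonzero orthogonal self-adjoint idempotents with sum [e]
    ([split_projection]).  Both generate right ideals strictly smaller than
    that of [e], so repeated splitting stops by induction on the dimension of
    these right ideals ([projection_decomposition]). *)

Set Implicit Arguments.
Unset Strict Implicit.
Unset Printing Implicit Defensive.

Import GRing.Theory Num.Theory.
Local Open Scope ring_scope.

(** * Definite involutions *)

Definition definite_involution (A : nzRingType) (s : A -> A) : Prop :=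
  [/\ {morph s : a b / a + b}, forall a b, s (a * b) = s b * s a,
      involutive s & forall a b, s a * a + s b * b = 0 -> a = 0].

Definition projection (A : nzRingType) (s : A -> A) (p : A) : Prop :=
  idempotent_elt p /\ s p = p.

Lemma involutionB (A : nzRingType) (s : A -> A) :
  definite_involution s -> {morph s : a b / a - b}.
Proof.
case=> sD _ _ _ a b; apply: (addIr (s b)).
by rewrite -sD !subrK.
Qed.

Lemma involution1 (A : nzRingType) (s : A -> A) :
  definite_involution s -> s 1 = 1.
Proof. by case=> _ sM sK _; rewrite -[LHS]mulr1 -{2}[1]sK -sM mulr1 sK. Qed.

Lemma projectionB (A : nzRingType) (s : A -> A) (e p : A) :
  definite_involution s -> projection s e -> projection s p ->
  e * p = p -> p * e = p -> projection s (e - p).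
Proof.
move=> sP [ee se] [pp sp] ep pe; split; last by rewrite involutionB // se sp.
by rewrite /idempotent_elt mulrBl !mulrBr ee pp ep pe subrr subr0.
Qed.

(** In finite dimension an injective left multiplication is onto, so it reaches
    [1]; the right inverse obtained is then two-sided, again by injectivity. *)
Lemma left_regular_inverse (F : fieldType) (A : falgType F) (z : A) :
  (forall v, z * v = 0 -> v = 0) -> exists2 w, z * w = 1 & w * z = 1.
Proof.
move=> z_reg.
have kz : lker (amull z) == 0%VS.
  apply/lker0P => u v; rewrite !lfunE /= => zuv.
  by apply/eqP; rewrite -subr_eq0; apply/eqP/z_reg; rewrite mulrBr zuv subrr.
pose w := (amull z)^-1%VF 1.
have zw : z * w = 1 by have := lker0_lfunVK kz 1; rewrite lfunE.
exists w => //; apply/eqP; rewrite -subr_eq0; apply/eqP/z_reg.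
by rewrite mulrBr mulrA zw mul1r mulr1 subrr.
Qed.

(** With [c := g - s g], the element [z := 1 + s c * c] is invertible by
    definiteness.  It is self-adjoint and commutes with [g], as
    [g z = g (s g) g = z g]; hence [p := g (s g) z^-1] is self-adjoint, and
    [p g = g (s g) g z^-1 = g].  The conclusions [g p = p] and [p g = g] say
    that [p] and [g] generate the same right ideal. *)
Lemma projection_of_idempotent (F : fieldType) (A : falgType F) (s : A -> A)
    (g : A) :
  definite_involution s -> idempotent_elt g ->
  exists2 p, projection s p & g * p = p /\ p * g = g.
Proof.
move=> sP gg; have [sD sM sK s_def] := sP.
have s1 := involution1 sP; have sB := involutionB sP.
rewrite /idempotent_elt in gg.
set g' := s g; have g'g' : g' * g' = g' by rewrite /g' -sM gg.
have sg' : s g' = g by exact: sK.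
pose c := g - g'; pose z := 1 + s c * c.
(* These two forms of [z] make its products with [g] on either side collapse. *)
have z1 : z = (1 - g) * (1 - g') + g' * g.
  rewrite /z /c sB sg' !mulrBl !mulrBr gg g'g' !mul1r mulr1 -/g'.
  by rewrite !opprB !addrA [LHS](ACl (1*3*4*5*2)).
have z2 : z = (1 - g') * (1 - g) + g * g'.
  rewrite z1 !mulrBl !mulrBr !mul1r !mulr1.
  by rewrite !opprB !addrA [LHS](ACl (1*4*5*2*3)).
have gz : g * z = g * g' * g.
  by rewrite z1 mulrDr !mulrA [g * (1 - g)]mulrBr mulr1 gg subrr mul0r add0r.
have zg : z * g = g * g' * g.
  rewrite z2 mulrDl -[X in X + _]mulrA [(1 - g) * g]mulrBl mul1r gg subrr.
  by rewrite mulr0 add0r.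
have sz : s z = z by rewrite /z sD s1 sM sK.
have [v zv|w zw wz] := @left_regular_inverse F A z.
  apply: (s_def v (c * v)).
  by rewrite sM -mulrA [s c * _]mulrA -mulrDr -[X in X + _]mul1r -mulrDl zv mulr0.
have sw : s w = w by rewrite -[LHS]mulr1 -zw mulrA -{1}sz -sM zw s1 mul1r.
have gw : g * w = w * g.
  by rewrite -[RHS]mulr1 -zw mulrA -[w * g * z]mulrA gz -zg mulrA wz mul1r.
have g'w : g' * w = w * g' by rewrite /g' -{1}sw -sM -gw sM sw.
pose p := g * g' * w.
have gp : g * p = p by rewrite /p !mulrA gg.
have pg : p * g = g by rewrite /p -mulrA -gw mulrA -gz -mulrA zw mulr1.
exists p => //; split; first by rewrite /idempotent_elt -{2}gp mulrA pg.
by rewrite /p !sM sg' sw -/g' mulrA -gw -[LHS]mulrA -g'w mulrA.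
Qed.

(** The projection generating the right ideal of a proper summand of [e] is
    again a proper summand of [e]: it is nonzero and differs from [e] because
    its right ideal is neither [0] nor that of [e]. *)
Lemma split_projection (F : fieldType) (A : falgType F) (s : A -> A) (e : A) :
  definite_involution s -> projection s e -> e <> 0 ->
  ~ primitive_idempotent e ->
  exists2 p, projection s p & [/\ e * p = p, p * e = p, p <> 0 & p <> e].
Proof.
move=> sP [ee se] e0 e_nprim; have [_ sM _ _] := sP.
have [g [h [gg hh [g0 h0] [gh hg] egh]]] :
  exists g h : A, [/\ idempotent_elt g, idempotent_elt h, g <> 0 /\ h <> 0,
                      g * h = 0 /\ h * g = 0 & e = g + h].
  by apply: contrapT => no_split; apply: e_nprim.
have [p [pp sp] [gp pg]] := projection_of_idempotent sP gg.
have ep : e * p = p by rewrite -gp mulrA egh mulrDl gg hg addr0.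
have pe : p * e = p by rewrite -{1}sp -{1}se -sM ep.
exists p; split=> // [p0|pE]; first by apply: g0; rewrite -pg p0 mul0r.
apply: h0; apply: (addrI g); rewrite addr0 -egh -pE -gp pE.
by rewrite egh mulrDr gg gh addr0.
Qed.

(** * Decomposition into primitive projections *)

Definition primitive_projection_sum (A : nzRingType) (s : A -> A) (e : A) :=
  exists (l : nat) (f : 'I_l -> A),
    [/\ e = \sum_(i < l) f i,
        forall i : 'I_l, primitive_idempotent (f i),
        forall i : 'I_l, s (f i) = f i &
        forall i j : 'I_l, i <> j -> f i * f j = 0].

(** Each summand of [p] is fixed by multiplication by [p] on either side, which
    makes it orthogonal to everything orthogonal to [p]. *)
Lemma primitive_projection_sumD (A : nzRingType) (s : A -> A) (p q : A) :
  p * q = 0 -> q * p = 0 ->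
  primitive_projection_sum s p -> primitive_projection_sum s q ->
  primitive_projection_sum s (p + q).
Proof.
move=> pq qp [m [f [pE f_prim sf f_orth]]] [n [g [qE g_prim sg g_orth]]].
have absorb k (u : 'I_k -> A) x : x = \sum_i u i ->
    (forall i, primitive_idempotent (u i)) ->
    (forall i j, i <> j -> u i * u j = 0) ->
    forall i, x * u i = u i /\ u i * x = u i.
  move=> -> u_prim u_orth i; have [uu _ _] := u_prim i; split.
    rewrite mulr_suml (bigD1 i) //= uu big1 ?addr0 // => j /eqP; exact: u_orth.
  rewrite mulr_sumr (bigD1 i) //= uu big1 ?addr0 // => j /eqP ji.
  by apply: u_orth => /esym.
have fp := absorb _ _ _ pE f_prim f_orth; have gq := absorb _ _ _ qE g_prim g_orth.
pose fg (k : 'I_(m + n)) := match split k with inl i => f i | inr j => g j end.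
exists (m + n)%N, fg; rewrite /fg; split.
- rewrite big_split_ord pE qE; congr (_ + _); apply: eq_bigr => i _.
    by rewrite (unsplitK (inl i)).
  by rewrite (unsplitK (inr i)).
- by move=> k; case: (split k).
- by move=> k; case: (split k).
move=> k k' kk'; have : split k <> split k' by move/(can_inj (@splitK m n)).
case: (split k) => i; case: (split k') => j ij.
- by apply: f_orth => eij; apply: ij; rewrite eij.
- by rewrite -(fp i).2 -(gq j).1 mulrA -(mulrA (f i)) pq mulr0 mul0r.
- by rewrite -(gq i).2 -(fp j).1 mulrA -(mulrA (g i)) qp mulr0 mul0r.
- by apply: g_orth => eij; apply: ij; rewrite eij.
Qed.

(** The inclusion of right ideals is strict because [p] fixes the elements of
    its own ideal from the left, while [p * e = p] differs from [e]. *)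
Lemma right_ideal_dim_lt (F : fieldType) (A : falgType F) (e p : A) :
  idempotent_elt e -> idempotent_elt p -> e * p = p -> p * e = p -> p <> e ->
  (\dim (limg (amull p)) < \dim (limg (amull e)))%N.
Proof.
move=> ee pp ep pe pNe.
have peS : (limg (amull p) <= limg (amull e))%VS.
  apply/subvP => _ /memv_imgP[x _ ->].
  by rewrite lfunE /= -ep -mulrA -[e * _](lfunE (e \*o idfun)) memv_img ?memvf.
rewrite (ltn_leqif (dimv_leqif_sup peS)); apply/negP => /subvP eS.
have /eS/memv_imgP[x _] : e \in limg (amull e).
  by apply/memv_imgP; exists e; rewrite ?memvf // lfunE /= ee.
rewrite lfunE /= => ex.
by apply: pNe; rewrite -pe ex mulrA pp.
Qed.

Theorem projection_decomposition (F : fieldType) (A : falgType F) (s : A -> A)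
    (e : A) :
  definite_involution s -> projection s e -> primitive_projection_sum s e.
Proof.
move=> sP; have [n] := ubnP (\dim (limg (amull e))).
elim: n e => // n IHn e dim_e [ee se].
have [->|e0] := EM (e = 0).
  by exists 0%N, (fun=> 0); rewrite big_ord0; split=> // [] [].
have [e_prim|e_nprim] := EM (primitive_idempotent e).
  exists 1%N, (fun=> e); rewrite big_ord1; split=> // i j.
  by rewrite !ord1.
have [p pP [ep pe p0 pNe]] := split_projection sP (conj ee se) e0 e_nprim.
have qP := projectionB sP (conj ee se) pP ep pe; have [pp _] := pP.
have smaller r : projection s r -> e * r = r -> r * e = r -> r <> e ->
    primitive_projection_sum s r.
  move=> rP er re rNe; have [rr _] := rP; apply: IHn => //.
  exact: leq_trans (right_ideal_dim_lt ee rr er re rNe) _.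
rewrite -[e](subrK p); apply: primitive_projection_sumD.
- by rewrite mulrBl ep pp subrr.
- by rewrite mulrBr pe pp subrr.
- apply: smaller; rewrite ?mulrBr ?mulrBl ?ee ?ep ?pe // => /eqP.
  by rewrite -subr_eq0 addrAC subrr add0r oppr_eq0 => /eqP.
- exact: smaller.
Qed.

(** * The complex group ring of the symmetric group *)

HB.instance Definition _ (R : realType) (N : nat) :=
  Algebra_isFalgebra.Build R[i] (sgring R N).

Definition sgadj (R : realType) (N : nat) (a : sgring R N) : sgring R N :=
  sgstar (sgconj a).

Lemma gcoef_sgadj (R : realType) (N : nat) (a : sgring R N) (p : 'S_N) :
  gcoef (sgadj a) p = Num.conj (gcoef a (p^-1)%g).
Proof. by rewrite gcoef_sgstar gcoef_sgconj. Qed.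

Lemma gcoef_sgadj_mul1 (R : realType) (N : nat) (a : sgring R N) :
  gcoef (sgadj a * a) 1%g = \sum_p `|gcoef a p| ^+ 2.
Proof.
rewrite gcoef_mul (reindex_inj invg_inj) /=; apply: eq_bigr => p _.
by rewrite gcoef_sgadj mul1g !invgK normCKC.
Qed.

(** The coefficient at the identity of [a^* a + b^* b] is a sum of squared
    moduli that includes those of all the coefficients of [a]. *)
Lemma sgadj_definite (R : realType) (N : nat) :
  definite_involution (@sgadj R N).
Proof.
split.
- by move=> a b; apply/sgringP => p; rewrite gcoefD !gcoef_sgadj gcoefD rmorphD.
- move=> a b; apply/sgringP => r; rewrite gcoef_sgadj !gcoef_mul rmorph_sum /=.
  rewrite [RHS](reindex_inj (mulIg r)) /=; apply: eq_bigr => p _.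
  by rewrite !gcoef_sgadj rmorphM mulrC /= !(invMg, invgK) mulgK.
- by move=> a; apply/sgringP => p; rewrite !gcoef_sgadj invgK conjCK.
move=> a b /(congr1 (fun c => gcoef c 1%g)); rewrite gcoefD !gcoef_sgadj_mul1.
have sq_ge0 (c : sgring R N) p : 0 <= `|gcoef c p| ^+ 2 by rewrite exprn_ge0.
rewrite [RHS]/gcoef ffunE => /eqP; rewrite paddr_eq0 ?sumr_ge0 // => /andP[+ _].
rewrite psumr_eq0 // => /allP a0; apply/sgringP => p.
have := a0 p (mem_index_enum p).
by rewrite /= sqrf_eq0 normr_eq0 /gcoef ffunE => /eqP.
Qed.

Theorem theorem3p1 (R : realType) (N K : nat) (hN : (1 <= N)%N)
    (hK : (1 <= K)%N) (f0 : sgring R N)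
    (hf0 : central_generating_idempotent (@annJ0 R N K) f0)
    (e : sgring R N) (heJ : complement_ideal f0 e)
    (he : idempotent_elt e) (hestar : sgstar (sgconj e) = e) :
  exists (l : nat) (f : 'I_l -> sgring R N),
    [/\ e = \sum_(i < l) f i,
        forall i : 'I_l, primitive_idempotent (f i),
        forall i : 'I_l, sgstar (sgconj (f i)) = f i &
        forall i j : 'I_l, i <> j -> f i * f j = 0].
Proof.
exact: projection_decomposition (sgadj_definite R N) (conj he hestar).
Qed.
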